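(* Let $f$ be a $\vartheta$-self-concordant barrier with domain $D_f\subset\mathbb{R}^n$ and Hessian $H$, let $K := 4\vartheta+1$, and suppose that $D_f\subset\mathbb{R}_{>0}^n$. Consider $x\in D_f$ such that for all $i\in\{1,\dots,n\}$, $x+(K+1)x_ie_i\in D_f$ and $x-\frac12x_ie_i\in D_f$, where $e_i$ is the $i$th vector of the canonical basis of $\mathbb{R}^n$. Then $$H(x)\preccurlyeq 4nK^2\operatorname{Diag}\Big(\frac1{x^2}\Big).$$
   Context: $f$ is a $C^2$ real-valued function on an open convex set $D_f \subset \mathbb{R}^n$, with gradient $g(x)$ and positive definite Hessian $H(x)$. Put $\|v\|_x := \sqrt{v^\top H(x) v}$ and $B_x(y,r) := \{z\in\mathbb{R}^n : \|y-z\|_x < r\}$. $f$ is (strongly nondegenerate) self-concordant if for all $x \in D_f$ we have $B_x(x,1) \subset D_f$ and, for all $y \in B_x(x,1)$ and $v \neq 0$, $1-\|y-x\|_x \leq \|v\|_y/\|v\|_x \leq 1/(1-\|y-x\|_x)$. It is a $\vartheta$-self-concordant barrier if moreover $\vartheta := \sup_{x \in D_f} \|H(x)^{-1}g(x)\|_x^2 < \infty$. $\operatorname{Diag}(1/x^2)$ is the diagonal matrix with diagonal entries $1/x_i^2$, and $A\preccurlyeq B$ means $z^\top Az\leq z^\top Bz$ for all $z\in\mathbb{R}^n$. *)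

(* Defs.v *)
From HB Require Import structures.
From mathcomp Require Import all_boot all_order all_algebra.
From mathcomp Require Import all_classical all_reals all_analysis.

Set Implicit Arguments.
Unset Strict Implicit.
Unset Printing Implicit Defensive.
Import Order.TTheory GRing.Theory Num.Theory.
Import numFieldNormedType.Exports.

Local Open Scope classical_set_scope.
Local Open Scope ring_scope.

Section QuadraticForms.
Context {R : realType} {n : nat}.
Implicit Types (A B : 'M[R]_n) (v : 'cV[R]_n).

Definition quad A v : R := (v^T *m A *m v) 0 0.

(* Symmetry is not part of the definition: it is only applied to Hessians of
   C^2 functions, which are symmetric. *)
Definition posdef A : Prop := forall v, v != 0 -> 0 < quad A v.

Definition loewner_le A B : Prop := forall v, quad A v <= quad B v.

End QuadraticForms.

Section SelfConcordance.
Context {R : realType} {n : nat}.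
(* Only the values of f on the open set D matter. *)
Implicit Types (D : set 'cV[R]_n) (f : 'cV[R]_n -> R) (x y z v : 'cV[R]_n).

Definition gradient f x : 'cV[R]_n := \col_i 'D_(delta_mx i 0) f x.

Definition hessian f x : 'M[R]_n :=
  \matrix_(i, j) 'D_(delta_mx j 0) (fun y => gradient f y i 0) x.

(* Differentiability is in the sense of Fréchet. D is meant to be open, so that
   the gradient is determined near each point of D. *)
Definition C2_on D f : Prop :=
  forall x, D x ->
    [/\ differentiable f x, differentiable (gradient f) x
      & {for x, continuous (hessian f)}].

Definition local_norm f x v : R := Num.sqrt (quad (hessian f x) v).

Definition local_ball f x y (r : R) : set 'cV[R]_n :=
  [set z | local_norm f x (y - z) < r].

Definition self_concordant D f : Prop :=
  [/\ open D,
      @convex_set R 'cV[R]_n D,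
      C2_on D f,
      forall x, D x -> posdef (hessian f x)
    & forall x, D x ->
        local_ball f x x 1 `<=` D /\
        forall y v, local_ball f x x 1 y -> v != 0 ->
          1 - local_norm f x (y - x) <= local_norm f y v / local_norm f x v
            <= 1 / (1 - local_norm f x (y - x))].

(* The supremum is taken in the extended reals; equality with the real number
   theta includes its finiteness. *)
Definition self_concordant_barrier D f (theta : R) : Prop :=
  self_concordant D f /\
  theta%:E = ereal_sup
    [set (local_norm f x (invmx (hessian f x) *m gradient f x) ^+ 2)%:E
       | x in D].

End SelfConcordance.

(* Main.v *)
Require Import Defs.
From HB Require Import structures.
From mathcomp Require Import all_boot all_order all_algebra.
From mathcomp Require Import all_classical all_reals all_analysis.
From mathcomp Require Import ring lra.

(* Let w be a multiple of e_i with x + w in D and <g(x), w> >= 0; one of the two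
   points of D on the line x + R e_i given by the hypothesis provides such a w,
   according to the sign of g_i(x). A barrier satisfies ||w||_x <= K, hence
   x_i^2 H_ii <= 4 K^2. Finally a positive definite matrix of size n is bounded
   by n times its diagonal part, since
   (v_i e_i - v_j e_j)^T H (v_i e_i - v_j e_j) >= 0 for all i and j. *)

Set Implicit Arguments.
Unset Strict Implicit.
Unset Printing Implicit Defensive.
Import Order.TTheory GRing.Theory Num.Theory.
Import numFieldNormedType.Exports.
Local Open Scope classical_set_scope.
Local Open Scope ring_scope.

(** * Calculus in one variable and along lines *)

Lemma MVT_cc (R : realType) (f df : R -> R) (a b : R) :
  a < b -> (forall t, a <= t <= b -> is_derive t 1 f (df t)) ->
  exists2 c, a <= c <= b & f b - f a = df c * (b - a).
Proof.
move=> ab fdf; have [| |c] := @MVT_segment R f df a b (ltW ab).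
- by move=> t /[!in_itv]/= /andP[at_ tb]; apply: fdf; rewrite !ltW.
- apply: derivable_within_continuous => t; rewrite in_itv/= => /fdf tab.
  exact: ex_derive.
- by rewrite in_itv/= => cab E; exists c.
Qed.

Lemma derive_ge0_le (R : realType) (f df : R -> R) (a b : R) :
  a < b -> (forall t, a <= t <= b -> is_derive t 1 f (df t)) ->
  (forall t, a <= t <= b -> 0 <= df t) -> f a <= f b.
Proof.
move=> ab fdf df0; have [c cab E] := MVT_cc ab fdf.
by rewrite -subr_ge0 E mulr_ge0 ?df0// subr_ge0 ltW.
Qed.

Lemma is_derive_line (R : realType) (V : normedModType R) (f : V -> R)
    (x e : V) (t d : R) :
  is_derive (x + t *: e) e f d ->
  is_derive t 1 (fun s : R => f (x + s *: e)) d.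
Proof.
have E : (fun h : R =>
    h^-1 *: (((fun s : R => f (x + s *: e)) \o shift t) (h *: 1) -
      f (x + t *: e))) =
  (fun h : R => h^-1 *: ((f \o shift (x + t *: e)) (h *: e) - f (x + t *: e))).
  apply/funext => h /=; congr (_ *: (f _ - _)).
  by rewrite /shift/= [h *: (1 : R)]mulr1 scalerDl addrCA.
by move=> [dfe dfE]; split; rewrite /derivable /derive E.
Qed.

(** * Symmetry of mixed second derivatives *)

Section Schwarz.
Variables (R : realType) (V : normedModType R).

(** Two applications of the mean value theorem: first in the direction [u], to the difference of [f]
    on two parallel lines, then in the direction [v], to [fu]. *)
Lemma second_difference (f fu fuv : V -> R) (x u v : V) (s : R) : 0 < s ->
  (forall p q, 0 <= p <= s -> 0 <= q <= s ->
     is_derive (x + p *: u + q *: v) u f (fu (x + p *: u + q *: v)) /\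
     is_derive (x + p *: u + q *: v) v fu (fuv (x + p *: u + q *: v))) ->
  exists p q, [/\ 0 <= p <= s, 0 <= q <= s &
    f (x + s *: u + s *: v) - f (x + s *: u) - f (x + s *: v) + f x =
    s ^+ 2 * fuv (x + p *: u + q *: v)].
Proof.
move=> s0 dF.
have s0s : 0 <= s <= s by rewrite lexx ltW.
have z0s : 0 <= (0 : R) <= s by rewrite lexx ltW.
pose F p := f (x + s *: v + p *: u) - f (x + p *: u).
pose dFu p := fu (x + s *: v + p *: u) - fu (x + p *: u).
have dFp p : 0 <= p <= s -> is_derive p (1 : R) F (dFu p).
  move=> ps; apply: is_deriveB; apply: is_derive_line.
    by rewrite addrAC; exact: (dF p s ps s0s).1.
  by move: (dF p 0 ps z0s).1; rewrite scale0r addr0; exact.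
have [c cs Ec] := MVT_cc s0 dFp.
pose G q := fu (x + c *: u + q *: v).
pose dGv q := fuv (x + c *: u + q *: v).
have dGq q : 0 <= q <= s -> is_derive q (1 : R) G (dGv q).
  by move=> qs; exact: (is_derive_line (dF c q cs qs).2).
have [d ds Ed] := MVT_cc s0 dGq.
exists c, d; split => //.
move: Ec Ed; rewrite /F /dFu /G /dGv !scale0r !addr0 !subr0.
rewrite [x + s *: v + s *: u]addrAC [x + s *: v + c *: u]addrAC => Ec Ed.
move: Ec; rewrite Ed => Ec.
rewrite [RHS]mulrC expr2 mulrA -Ec; ring.
Qed.

(** The second difference of [f] is symmetric in [u] and [v], so [fuv] and [fvu] take a common value
    at two points arbitrarily close to [x]. By continuity their values at [x] cannot differ. *)
Lemma mixed_derive_comm (f fu fv fuv fvu : V -> R) (x u v : V) :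
  (\forall y \near x, [/\ is_derive y u f (fu y), is_derive y v f (fv y),
     is_derive y v fu (fuv y) & is_derive y u fv (fvu y)]) ->
  {for x, continuous fuv} -> {for x, continuous fvu} -> fuv x = fvu x.
Proof.
move=> dF cuv cvu; apply/eqP/negPn/negP => neq.
have e0 : 0 < `|fuv x - fvu x| / 2 by rewrite divr_gt0// normr_gt0 subr_eq0.
have nuv : \forall y \near x, `|fuv x - fuv y| < `|fuv x - fvu x| / 2.
  by move/cvgrPdist_lt : cuv; apply.
have nvu : \forall y \near x, `|fvu x - fvu y| < `|fuv x - fvu x| / 2.
  by move/cvgrPdist_lt : cvu; apply.
have [d d0 Hd] := (nbhs_ballP x _).1 (filterI dF (filterI nuv nvu)).
have {}d0 : 0 < d := d0.
(* Small enough for the whole parallelogram of side [s] to lie in the ball: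
   [s * (|u| + |v| + 1) = d / 2]. The summand 1 keeps the denominator positive when [u] and [v]
   vanish. *)
pose s := d / (`|u| + `|v| + 1) / 2.
have N0 : 0 < `|u| + `|v| + 1 by rewrite ltr_wpDl// addr_ge0.
have s0 : 0 < s by rewrite !divr_gt0.
have Hs p q : 0 <= p <= s -> 0 <= q <= s -> ball x d (x + p *: u + q *: v).
  move=> /andP[p0 ps] /andP[q0 qs]; rewrite -ball_normE /ball_/=.
  rewrite -addrA opprD addNKr normrN (le_lt_trans (ler_normD _ _))// !normrZ.
  rewrite !ger0_norm//.
  rewrite (@le_lt_trans _ _ (s * (`|u| + `|v|)))//.
    by rewrite mulrDr lerD// ler_wpM2r.
  rewrite (@le_lt_trans _ _ (s * (`|u| + `|v| + 1)))//.
    by rewrite ler_wpM2l// ?ltW// ltrDl.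
  by rewrite /s mulrAC divfK ?gt_eqF//; lra.
have Hs' p q : 0 <= p <= s -> 0 <= q <= s -> ball x d (x + p *: v + q *: u).
  by move=> ? ?; rewrite addrAC; exact: Hs.
have [p [q [ps qs E1]]] := second_difference s0 (fun p q ps qs =>
  let: conj (And4 h1 _ h2 _) _ := Hd _ (Hs p q ps qs) in conj h1 h2).
have [p' [q' [ps' qs' E2]]] := second_difference s0 (fun p q ps qs =>
  let: conj (And4 _ h1 _ h2) _ := Hd _ (Hs' p q ps qs) in conj h1 h2).
(* Both sides, multiplied by [s ^+ 2], are the same second difference. *)
have E : fuv (x + p *: u + q *: v) = fvu (x + p' *: v + q' *: u).
  apply: (@mulfI _ (s ^+ 2)); first by rewrite expf_neq0 ?gt_eqF.
  by rewrite -E1 -E2 [x + s *: v + s *: u]addrAC; ring.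
have [_ [h1 _]] := Hd _ (Hs _ _ ps qs).
have [_ [_]] := Hd _ (Hs' _ _ ps' qs'); rewrite -E distrC => h2.
have := le_lt_trans (ler_distD _ _ _) (ltrD h1 h2).
by rewrite -splitr ltxx.
Qed.

End Schwarz.

(* Parametrise the segment by u = a t in [0, a] and rescale g and h accordingly:
   integrating h >= (1 - u)^2 over [0, 1/2] gives g(1/2) >= 7/24, and integrating
   g' >= g^2 / theta from there on gives g(1/2) (a - 1/2) < theta. *)
Lemma barrier_length_le (R : realType) (g h : R -> R) (a theta : R) :
  0 <= theta ->
  (forall t : R, 0 <= t <= 1 -> is_derive t 1 g (h t)) ->
  (forall t : R, 0 <= t <= 1 -> 0 < h t) ->
  (forall t : R, 0 <= t <= 1 -> g t ^+ 2 <= theta * h t) ->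
  (forall t : R, 0 <= t <= 1 -> t * a < 1 -> a * (1 - t * a) <= Num.sqrt (h t)) ->
  0 <= g 0 -> a <= 4 * theta + 1.
Proof.
move=> th0 dg h0 gh sc g0.
(* A small [a] satisfies the bound because [theta] is nonnegative. Otherwise the time [s] below, at
   which [t * a] reaches 1/2, comes before 1. *)
have [a12|a12] := leP a (1 / 2); first lra.
have a0 : 0 < a by lra.
pose s := 1 / (2 * a).
have sa : s * a = 1 / 2 by rewrite /s; field; rewrite gt_eqF.
have s0 : 0 < s by rewrite divr_gt0// mulr_gt0.
have s1 : s < 1.
  by rewrite -(ltr_pM2r a0) sa; lra.
have gs : 7 / 24 * a <= g s.
  (* The added term has derivative [- (a * (1 - t * a)) ^+ 2]. It equals [a / 3] at 0 and [a / 24]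
     at [s], whence the gain of [7 / 24 * a]. *)
  have := @derive_ge0_le _ (fun t : R => g t + a * (1 - t * a) ^+ 3 / 3)
    (fun t : R => h t - (a * (1 - t * a)) ^+ 2) 0 s s0.
  have d (t : R) : 0 <= t <= s -> is_derive t (1 : R)
      (fun t : R => g t + a * (1 - t * a) ^+ 3 / 3) (h t - (a * (1 - t * a)) ^+ 2).
    move=> /andP[t0 ts].
    have dgt : is_derive t 1 g (h t) by apply: dg; lra.
    apply: is_derive_eq => /=.
    by rewrite /GRing.scale/= mulr0; field.
  move=> /(_ d); rewrite mul0r sa => /(_ _).
  move=> H; have : forall t, 0 <= t <= s -> 0 <= h t - (a * (1 - t * a)) ^+ 2.
    move=> t /andP[t0 ts]; have t01 : 0 <= t <= 1 by lra.
    have ta : t * a <= 1 / 2 by rewrite -sa ler_wpM2r// ltW.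
    have ta1 : t * a < 1 by lra.
    rewrite subr_ge0 -[leRHS]sqr_sqrtr; last by rewrite ltW// h0.
    rewrite lerXn2r ?nnegrE ?sqrtr_ge0 ?sc//.
    by apply: mulr_ge0; lra.
  move/H; lra.
have gpos t : s <= t <= 1 -> 0 < g t.
  move=> /andP[]; rewrite le_eqVlt => /predU1P[<- _|st t1].
    by apply: lt_le_trans gs; rewrite mulr_gt0.
  apply: (@lt_le_trans _ _ (g s)).
    by apply: lt_le_trans gs; rewrite mulr_gt0.
  apply: (derive_ge0_le st (df := h)) => r /andP[sr rt].
    by apply: dg; lra.
  by apply/ltW/h0; lra.
have s01 : 0 <= s <= 1 by lra.
have ss1 : s <= s <= 1 by lra.
(* If [theta] were 0, then [g s ^+ 2 <= theta * h s] would contradict [0 < g s]. *)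
have thp : 0 < theta.
  rewrite lt_neqAle th0 andbT; apply/eqP => th.
  have := gh s s01; rewrite -th mul0r leNgt => /negP; apply.
  by rewrite exprn_gt0// gpos.
have key : g s * (1 - s) <= theta.
  (* Monotonicity of this function is the integrated form of [h >= g ^+ 2 / theta]. Dropping the
     positive term [(g 1)^-1] then bounds [(1 - s) / theta] by [(g s)^-1]. *)
  have := @derive_ge0_le _ (fun t : R => - (g t)^-1 - t / theta)
    (fun t : R => (h t * theta - g t ^+ 2) / (g t ^+ 2 * theta)) s 1 s1.
  have d (t : R) : s <= t <= 1 -> is_derive t (1 : R)
      (fun t : R => - (g t)^-1 - t / theta)
      ((h t * theta - g t ^+ 2) / (g t ^+ 2 * theta)).
    move=> ts; have dgt : is_derive t 1 g (h t) by apply: dg; lra.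
    have gt0 : g t != 0 by rewrite gt_eqF// gpos.
    have dV := is_deriveV gt0 dgt.
    apply: is_derive_eq => /=.
    rewrite /GRing.scale/=; field.
    by rewrite gt0 gt_eqF.
  move=> /(_ d) H; have {}H := H _.
  have /H : forall t, s <= t <= 1 ->
      0 <= (h t * theta - g t ^+ 2) / (g t ^+ 2 * theta).
    move=> t ts; rewrite divr_ge0//.
      by rewrite subr_ge0 mulrC gh//; lra.
    by rewrite mulr_ge0// exprn_ge0// ltW// gpos.
  have g1 : 0 < (g 1)^-1 by rewrite invr_gt0 gpos; lra.
  move=> {}H; have {}H : (1 - s) / theta <= (g s)^-1 by lra.
  rewrite mulrC -ler_pdivlMr ?gpos// -ler_pdivrMl// mulrC.
  exact: H.
have : 7 / 24 * a * (1 - s) <= theta.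
  by apply: le_trans key; rewrite ler_wpM2r//; lra.
(* As [a * s = 1 / 2], this reads [7 / 24 * (a - 1 / 2) <= theta], that is,
   [a <= 24 / 7 * theta + 1 / 2]. *)
rewrite mulrBr mulr1 -[_ * a * s]mulrA [a * s]mulrC sa; lra.
Qed.

(** * Quadratic forms of positive definite matrices *)

Section Quad.
Variables (R : realType) (n : nat).
Implicit Types (A : 'M[R]_n) (u v : 'cV[R]_n).

Lemma quadE A v : quad A v = \sum_i \sum_j v i 0 * A i j * v j 0.
Proof.
rewrite /quad mxE exchange_big; apply: eq_bigr => j _; rewrite mxE mulr_suml.
by apply: eq_bigr => i _; rewrite mxE.
Qed.

Lemma quad0 A : quad A 0 = 0.
Proof. by rewrite /quad mulmx0 mxE. Qed.

Lemma quad_delta A (c : R) i : quad A (c *: delta_mx i 0) = c ^+ 2 * A i i.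
Proof.
rewrite /quad [(c *: _)^T]linearZ/= trmx_delta -!(scalemxAl, scalemxAr) -rowE -colE !mxE.
by rewrite mulrA.
Qed.

Lemma quad_line A u v (c : R) :
  quad A (u - c *: v) = quad A u - c * (u^T *m A *m v) 0 0
    - c * (v^T *m A *m u) 0 0 + c ^+ 2 * quad A v.
Proof.
rewrite /quad [(u - _)^T]linearB/= [(c *: _)^T]linearZ/= !(mulmxBl, mulmxBr) -!(scalemxAl, scalemxAr).
rewrite !mxE; ring.
Qed.

Lemma posdef_quad_ge0 A v : posdef A -> 0 <= quad A v.
Proof. by move=> pA; have [->|/pA/ltW//] := eqVneq v 0; rewrite quad0. Qed.

(** The quadratic form vanishes on any vector of the left kernel. *)
Lemma posdef_unitmx A : posdef A -> A \in unitmx.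
Proof.
move=> pA; rewrite -row_free_unit -kermx_eq0; apply/eqP/row_matrixP => i.
rewrite row0; apply/eqP/negPn/negP => vN0.
have vA : row i (kermx A) *m A = 0 by apply/sub_kermxP/row_sub.
have := pA (row i (kermx A))^T; rewrite trmx_eq0 => /(_ vN0).
by rewrite /quad trmxK vA mul0mx mxE ltxx.
Qed.

(** The form is nonnegative at [u - c *: v]; the choice [c = b / quad A v] minimises it over [c]. *)
Lemma quad_cauchy_schwarz A u v : A^T = A -> posdef A ->
  (v^T *m A *m u) 0 0 ^+ 2 <= quad A u * quad A v.
Proof.
move=> sA pA; have [->|vN0] := eqVneq v 0.
  by rewrite trmx0 !mul0mx mxE expr0n/= quad0 mulr0.
set b := (v^T *m A *m u) 0 0; have qv := pA v vN0.
have E : (u^T *m A *m v) 0 0 = b.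
  have <- : (v^T *m A *m u)^T = u^T *m A *m v.
    by rewrite !trmx_mul trmxK sA mulmxA.
  by rewrite mxE.
have := posdef_quad_ge0 (u - (b / quad A v) *: v) pA; rewrite quad_line E -/b.
rewrite (_ : _ + _ = quad A u - b ^+ 2 / quad A v); last first.
  by field; rewrite gt_eqF.
by rewrite subr_ge0 ler_pdivrMr.
Qed.

Lemma quad_le_diag A v : posdef A ->
  quad A v <= n%:R * \sum_i v i 0 ^+ 2 * A i i.
Proof.
move=> pA; have H i j :
    v i 0 * A i j * v j 0 + v j 0 * A j i * v i 0 <=
    v i 0 ^+ 2 * A i i + v j 0 ^+ 2 * A j j.
  have := posdef_quad_ge0 (v i 0 *: delta_mx i 0 - v j 0 *: delta_mx j 0) pA.
  rewrite quad_line quad_delta.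
  have -> : quad A (delta_mx j 0) = A j j.
    by rewrite -[delta_mx j 0]scale1r quad_delta expr1n mul1r.
  have D (a : R) k l : ((a *: delta_mx k 0 : 'cV[R]_n)^T *m A *m (delta_mx l 0 : 'cV[R]_n)) 0 0 =
      a * A k l.
    by rewrite [(a *: _)^T]linearZ/= trmx_delta -!scalemxAl -rowE -colE !mxE.
  have D' (a : R) k l : ((delta_mx k 0 : 'cV[R]_n)^T *m A *m (a *: delta_mx l 0 : 'cV[R]_n)) 0 0 =
      a * A k l.
    by rewrite -scalemxAr trmx_delta -rowE -colE !mxE.
  by rewrite D D'; nra.
(* Doubling pairs the entry (i, j) with (j, i), so that [H] can be summed over all n^2 pairs; each
   diagonal term then occurs 2n times on the right. *)
have : quad A v + quad A v <= n%:R * (\sum_i v i 0 ^+ 2 * A i i) +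
                              n%:R * (\sum_i v i 0 ^+ 2 * A i i).
  rewrite quadE [X in _ + X <= _]exchange_big -big_split/=.
  under eq_bigr do rewrite -big_split/=.
  have -> : n%:R * (\sum_i v i 0 ^+ 2 * A i i) +
      n%:R * (\sum_i v i 0 ^+ 2 * A i i) =
      \sum_(i < n) \sum_(j < n) (v i 0 ^+ 2 * A i i + v j 0 ^+ 2 * A j j).
    under [RHS]eq_bigr do rewrite big_split/= sumr_const card_ord.
    by rewrite big_split/= sumr_const card_ord sumrMnl !mulr_natl.
  by apply: ler_sum => i _; apply: ler_sum => j _; exact: H.
lra.
Qed.

End Quad.

(** * Hessians and self-concordant barriers along segments *)

Section SelfConcordant.
Variables (R : realType) (n : nat) (D : set 'cV[R]_n) (f : 'cV[R]_n -> R).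
Implicit Types (x y v w : 'cV[R]_n).

Lemma is_derive_gradient_coord w y i : differentiable (gradient f) y ->
  is_derive y w (fun z => gradient f z i 0) (\sum_j hessian f y i j * w j 0).
Proof.
move=> dg.
have dgi : differentiable (fun z => gradient f z i 0) y.
  apply: (@differentiable_comp _ _ _ _ (gradient f)
            (fun N : 'cV[R]_n => N i 0)) => //.
  exact: differentiable_coord.
apply: DeriveDef; first exact: diff_derivable.
rewrite deriveE// [X in 'd _ _ X]matrix_sum_delta linear_sum/=.
apply: eq_bigr => j _; rewrite big_ord1 linearZ/= -deriveE// mxE mulrC.
by rewrite (ord1 ord0).
Qed.

Lemma is_derive_gradient w y : differentiable (gradient f) y ->
  is_derive y w (fun z => (w^T *m gradient f z) 0 0) (quad (hessian f y) w).
Proof.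
move=> dg.
have -> : (fun z => (w^T *m gradient f z) 0 0) =
    \sum_i (fun z => w i 0 *: gradient f z i 0).
  apply/funext => z; rewrite fct_sumE mxE; apply: eq_bigr => i _.
  by rewrite mxE.
have -> : quad (hessian f y) w =
    \sum_i w i 0 *: (\sum_j hessian f y i j * w j 0).
  rewrite quadE; apply: eq_bigr => i _; rewrite scaler_sumr.
  by apply: eq_bigr => j _; rewrite -mulrA.
apply: is_derive_sum => i; apply: is_deriveZ.
exact: is_derive_gradient_coord.
Qed.

(** Supplies the symmetry that Cauchy-Schwarz requires and [posdef] does not include. *)
Lemma C2_hessian_sym x : open D -> C2_on D f -> D x ->
  (hessian f x)^T = hessian f x.
Proof.
move=> oD C2 Dx; apply/matrixP => j i; rewrite mxE.
have [_ _ cH] := C2 x Dx.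
have C k l : {for x, continuous (fun y => hessian f y k l)}.
  exact: (continuous_comp cH (@coord_continuous _ _ _ k l _)).
apply: (@mixed_derive_comm _ _ f (fun y => gradient f y i 0)
  (fun y => gradient f y j 0) (fun y => hessian f y i j)
  (fun y => hessian f y j i) x (delta_mx i 0) (delta_mx j 0) _ (C i j) (C j i)).
have dgrad y k l : D y ->
    is_derive y (delta_mx l 0) (fun z => gradient f z k 0) (hessian f y k l).
  move=> /C2[_ dg _].
  have := is_derive_gradient_coord (delta_mx l 0) k dg.
  rewrite (bigD1 l)//= big1 ?addr0; first by rewrite [delta_mx _ _ _ _]mxE !eqxx mulr1.
  by move=> m /negPf ml; rewrite [delta_mx _ _ _ _]mxE ml mulr0.
have df y k : D y -> is_derive y (delta_mx k 0) f (gradient f y k 0).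
  by move=> /C2[df _ _]; rewrite mxE; apply: derivableP; exact: diff_derivable.
apply: filterS (open_nbhs_nbhs (conj oD Dx)) => y Dy.
exact: And4 (df y i Dy) (df y j Dy) (dgrad y i j Dy) (dgrad y j i Dy).
Qed.

Lemma local_normZ x v (c : R) :
  local_norm f x (c *: v) = `|c| * local_norm f x v.
Proof.
rewrite /local_norm -sqrtr_sqr -sqrtrM ?sqr_ge0//; congr Num.sqrt.
rewrite /quad [(c *: v)^T]linearZ/= -!(scalemxAl, scalemxAr) !mxE; ring.
Qed.

Lemma convex_segment x w (t : R) : @convex_set R 'cV[R]_n D ->
  D x -> D (x + w) -> 0 <= t <= 1 -> D (x + t *: w).
Proof.
move=> cD Dx Dxw /andP[t0 t1].
have := cD (x + w) x (Itv01 t0 t1) (mem_set Dxw) (mem_set Dx).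
move/set_mem; congr D.
rewrite /conv/= /unstable.onem scalerDr scalerBl scale1r.
by rewrite addrC addrA subrK.
Qed.

(** With [u] the Newton direction [H^-1 g], the left side is the square of the inner product of [w]
    and [u] for [H]. Cauchy-Schwarz applies, and [theta] bounds the squared local norm of [u]. *)
Lemma barrier_gradient_le x w theta : self_concordant_barrier D f theta ->
  D x -> (w^T *m gradient f x) 0 0 ^+ 2 <= theta * quad (hessian f x) w.
Proof.
move=> [[oD _ C2 pH _] thE] Dx; have pHx := pH x Dx.
set H := hessian f x; pose u := invmx H *m gradient f x.
have -> : gradient f x = H *m u.
  by rewrite mulmxA mulmxV ?mul1mx//; exact: posdef_unitmx.
rewrite mulmxA.
apply: le_trans (quad_cauchy_schwarz u w (C2_hessian_sym oD C2 Dx) pHx) _.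
apply: ler_wpM2r; first exact: posdef_quad_ge0.
rewrite -lee_fin thE; apply: ereal_sup_ubound; exists x => //.
by rewrite /local_norm sqr_sqrtr//; exact: posdef_quad_ge0.
Qed.

Lemma barrier_parameter_ge0 theta : self_concordant_barrier D f theta ->
  D !=set0 -> 0 <= theta.
Proof.
move=> [_ thE] [x Dx]; rewrite -lee_fin thE.
apply: le_trans (ereal_sup_ubound _); last by exists x.
by rewrite lee_fin sqr_ge0.
Qed.

(** Restriction to the segment from [x] to [x + w]: [g] is the derivative of [f] along it, [h] the
    second derivative, and [barrier_length_le] applies with [a] the local norm of [w] at [x]. *)
Lemma barrier_local_norm_le x w theta : self_concordant_barrier D f theta ->
  D x -> D (x + w) -> 0 <= (w^T *m gradient f x) 0 0 ->
  local_norm f x w <= 4 * theta + 1.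
Proof.
move=> scb Dx Dxw gw0.
have th0 : 0 <= theta by apply: barrier_parameter_ge0 scb _; exists x.
have [->|wN0] := eqVneq w 0.
  by rewrite /local_norm quad0 sqrtr0; lra.
have [[oD cD C2 pH sc] _] := scb.
have seg (t : R) : 0 <= t <= 1 -> D (x + t *: w) by exact: convex_segment.
pose G z : R := (w^T *m gradient f z) 0 0.
pose g t : R := G (x + t *: w).
pose h t := quad (hessian f (x + t *: w)) w.
have dg (t : R) : 0 <= t <= 1 -> is_derive t (1 : R) g (h t).
  move=> /seg/C2[_ dg _].
  exact: (is_derive_line (f := G) (is_derive_gradient w dg)).
apply: (barrier_length_le th0 dg).
- by move=> t t01; exact: (pH _ (seg t t01) w wN0).
- move=> t t01; have := barrier_gradient_le w scb (seg t t01).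
  rewrite /g /G /h. exact.
- move=> t /andP[t0 t1] ta.
  have a0 : 0 < local_norm f x w by rewrite sqrtr_gt0; exact: pH.
  have xB : local_ball f x x 1 (x + t *: w).
    by rewrite /local_ball/= opprD addNKr -scaleNr local_normZ normrN ger0_norm.
  have tE : local_norm f x (x + t *: w - x) = t * local_norm f x w.
    by rewrite addrAC subrr add0r local_normZ ger0_norm.
  (* The lower self-concordance bound, at [y = x + t *: w] and [v = w], controls [Num.sqrt (h t)]
     from below. *)
  have [_ /(_ _ w xB wN0)/andP[+ _]] := sc x Dx.
  by rewrite tE (ler_pdivlMr _ _ a0) mulrC; exact.
- by rewrite /g scale0r addr0.
Qed.

End SelfConcordant.

(** * From coordinate directions to the Hessian bound *)

Theorem theorem6 (R : realType) (n : nat) (D : set 'cV[R]_n)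
    (f : 'cV[R]_n -> R) (theta : R) :
  let K : R := 4 * theta + 1 in
  self_concordant_barrier D f theta ->
  D `<=` [set x : 'cV[R]_n | forall i, 0 < x i 0] ->
  forall x : 'cV[R]_n, D x ->
  (forall i : 'I_n,
     D (x + ((K + 1) * x i 0) *: delta_mx i 0) /\
     D (x - (1 / 2 * x i 0) *: delta_mx i 0)) ->
  loewner_le (hessian f x)
    ((4 * n%:R * K ^+ 2) *: diag_mx (\row_i (1 / x i 0 ^+ 2))).
Proof.
move=> K scb Dpos x Dx hx.
have [[_ _ _ pH _] _] := scb; have pHx := pH x Dx.
have th0 : 0 <= theta by apply: barrier_parameter_ge0 scb _; exists x.
have K1 : 1 <= K by rewrite /K; lra.
have diag i : x i 0 ^+ 2 * hessian f x i i <= 4 * K ^+ 2.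
  have xi0 : 0 < x i 0 := Dpos x Dx i.
  have [Dp Dm] := hx i.
  have le_of c : D (x + c *: delta_mx i 0) -> 0 <= c * gradient f x i 0 ->
      c ^+ 2 * hessian f x i i <= K ^+ 2.
    move=> Dc gc.
    have cK : local_norm f x (c *: delta_mx i 0) <= K.
      apply: barrier_local_norm_le scb Dx Dc _.
      by rewrite [(c *: _)^T]linearZ/= trmx_delta -scalemxAl -rowE mxE [row _ _ _ _]mxE.
    rewrite -quad_delta -[leLHS]sqr_sqrtr ?posdef_quad_ge0//.
    by rewrite lerXn2r// ?nnegrE ?sqrtr_ge0//; lra.
  have Hx0 : 0 <= x i 0 ^+ 2 * hessian f x i i.
    by rewrite -quad_delta posdef_quad_ge0.
  (* For a nonnegative partial derivative, move up by [(K + 1) * x i 0]: the factor [(K + 1) ^+ 2]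
     is at least 1, so the bound holds with room to spare. *)
  have [g0|g0] := leP 0 (gradient f x i 0).
    have : 0 <= (K + 1) * x i 0 * gradient f x i 0.
      by rewrite !mulr_ge0 ?(ltW xi0)//; lra.
    move/(le_of _ Dp); rewrite exprMn -mulrA; nra.
  (* For a negative one, move down by half of [x i 0]; squaring the 1/2 produces the factor 4 of the
     bound. *)
  have Dm' : D (x + - (1 / 2 * x i 0) *: delta_mx i 0) by rewrite scaleNr.
  have : 0 <= - (1 / 2 * x i 0) * gradient f x i 0 by nra.
  move/(le_of _ Dm'); rewrite sqrrN exprMn; nra.
move=> v; apply: le_trans (quad_le_diag v pHx) _.
have -> : quad ((4 * n%:R * K ^+ 2) *: diag_mx (\row_i (1 / x i 0 ^+ 2))) v =
    n%:R * \sum_i v i 0 ^+ 2 * (4 * K ^+ 2 / x i 0 ^+ 2).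
  rewrite quadE mulr_sumr; apply: eq_bigr => i _.
  rewrite (bigD1 i)//= big1 ?addr0; last first.
    by move=> j /negPf ji; rewrite !mxE eq_sym ji mulr0n mulr0 mulr0 mul0r.
  by rewrite !mxE eqxx mulr1n mul1r; ring.
(* Both sides are now [n%:R] times sums over the coordinates, compared term by term through
   [diag]. *)
apply: ler_wpM2l => //; apply: ler_sum => i _.
apply: ler_wpM2l; first exact: sqr_ge0.
by rewrite ler_pdivlMr ?exprn_gt0 ?(Dpos x Dx i)// mulrC.
Qed.
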